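(* Let $\{X_k:k\ge 1\}$ be a sequence of i.i.d. $\mathcal{M}$-valued random variables, distributed as $X$, with finite variance $\sigma_d^2(X)<\infty$. For $n\ge 2$ define the estimator of the variance by $$\hat\sigma_d^2=\frac{1}{n-1}\sum_{k=1}^n\big\|h(X_k)-h(S_n)\big\|^2,\qquad S_n=H\Big(\frac1n\sum_{k=1}^n h(X_k)\Big).$$ Then $\hat\sigma_d^2$ is an unbiased estimator of $\sigma_d^2(X)$, that is, $E[\hat\sigma_d^2]=\sigma_d^2(X)$.
   Context: $\phi:\mathcal{J}\to\mathbb{R}$ is a strictly convex, three times continuously differentiable function with $\phi''>0$ on a bounded or unbounded interval $\mathcal{J}\subset\mathbb{R}$, and $\mathcal{M}=\mathcal{J}^K$. The function $h:\mathcal{J}\to\mathbb{R}$ is a primitive of $(\phi'')^{1/2}$ and $H=h^{-1}$ is its compositional inverse on $h(\mathcal{J})$; both act componentwise on vectors. The $d$-mean of $X$ is $E_d[X]=H(E[h(X)])$, and its $d$-variance is $\sigma_d^2(X)=E[\|h(X)-h(E_d[X])\|^2]$, with $\|\cdot\|$ the Euclidean norm on $\mathbb{R}^K$. *)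

(* Defs.v *)
From HB Require Import structures.
From mathcomp Require Import all_boot all_order all_algebra.
From mathcomp Require Import all_classical all_reals all_analysis.

Set Implicit Arguments.
Unset Strict Implicit.
Unset Printing Implicit Defensive.

Import Order.TTheory GRing.Theory Num.Theory.
Import numFieldNormedType.Exports.

Local Open Scope classical_set_scope.
Local Open Scope ring_scope.

(* Points of R^K are K.-tuples, which carry the product sigma-algebra
   (i.e. the Borel one) in MathComp-Analysis. *)

(* The limit of the difference quotient is taken along points of J only, so at
   an endpoint belonging to J this is the one-sided derivative. *)
Definition derivative_on (R : realType) (J : interval R) (f f' : R -> R) :=
  forall x, x \in J ->
    (f y - f x) / (y - x) @[y --> within [set` J] x^'] --> f' x.

Definition strictly_convex_on (R : realType) (J : interval R) (f : R -> R) :=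
  forall x y t : R, x \in J -> y \in J -> x != y -> 0 < t < 1 ->
    f (t * x + (1 - t) * y) < t * f x + (1 - t) * f y.

Definition valued_in (R : realType) (K : nat) (J : interval R) (T : Type)
    (X : T -> K.-tuple R) :=
  forall w i, tnth (X w) i \in J.

(* The norm of MathComp-Analysis on finite products is the sup norm. *)
Definition enorm2 (R : realType) (K : nat) (x : K.-tuple R) : R :=
  Num.sqrt (\sum_(i < K) tnth x i ^+ 2).

Definition vsub (R : realType) (K : nat) (x y : K.-tuple R) : K.-tuple R :=
  [tuple tnth x i - tnth y i | i < K].

Definition mutually_independent d d' (T : measurableType d)
    (T' : measurableType d') (R : realType) (P : probability T R)
    (X : nat -> {RV P >-> T'}) :=
  forall (s : seq nat) (B : nat -> set T'),
    uniq s -> (forall k, measurable (B k)) ->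
    P (\big[setI/setT]_(k <- s) (X k @^-1` B k))
      = (\prod_(k <- s) P (X k @^-1` B k))%E.

Definition identically_distributed d d' (T : measurableType d)
    (T' : measurableType d') (R : realType) (P : probability T R)
    (X Y : {RV P >-> T'}) :=
  forall B : set T', measurable B -> distribution P X B = distribution P Y B.

Section d_statistics.
Context d (T : measurableType d) (R : realType) (P : probability T R).
Variables (K : nat) (h H : R -> R).

Definition vexpectation (X : T -> K.-tuple R) : K.-tuple R :=
  [tuple fine 'E_P[fun w => tnth (X w) i] | i < K].

Definition d_mean (X : T -> K.-tuple R) : K.-tuple R :=
  map_tuple H (vexpectation (fun w => map_tuple h (X w))).

(* Since [fine] makes [d_mean X] a point even when E[h(X)] does not exist, the
   variance is always defined in [0, +oo]; when it is finite, h(X) is within a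
   constant of being square integrable, so E[h(X)] does exist. *)
Definition d_variance (X : T -> K.-tuple R) : \bar R :=
  'E_P[fun w =>
    enorm2 (vsub (map_tuple h (X w)) (map_tuple h (d_mean X))) ^+ 2].

(* The k-th observation of the sample is [X k.-1]. *)
Definition sample_d_mean (n : nat) (X : nat -> T -> K.-tuple R) (w : T) :
    K.-tuple R :=
  map_tuple H [tuple n%:R^-1 * \sum_(k < n) tnth (map_tuple h (X k w)) i | i < K].

Definition sample_d_variance (n : nat) (X : nat -> T -> K.-tuple R) (w : T) :
    R :=
  (n%:R - 1)^-1 * \sum_(k < n)
    enorm2 (vsub (map_tuple h (X k w)) (map_tuple h (sample_d_mean n X w))) ^+ 2.

End d_statistics.

(* Main.v *)
Require Import Defs.
From mathcomp Require Import all_boot all_order all_algebra.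
From mathcomp Require Import all_classical all_reals all_analysis.
From mathcomp Require Import measurable_realfun ring lra.

Set Implicit Arguments.
Unset Strict Implicit.
Unset Printing Implicit Defensive.

Import Order.TTheory GRing.Theory Num.Theory.
Import numFieldNormedType.Exports.
Local Open Scope classical_set_scope.
Local Open Scope ring_scope.

(** The transform h turns the geometry of the divergence into the Euclidean one:
    [h (E_d[X])] is [E[h(X)]] and [h (S_n)] is the ordinary sample mean of the
    [h(X_k)], so the claim is the classical unbiasedness of the sample variance
    (with Bessel's correction n - 1) for the vectors [h(X_k)], which splits into
    a sum over the K coordinates.

    Cancelling h against H needs the means to lie in h(J), because H inverts h
    only there.  As h is differentiable along J it is continuous on J, so h(J)
    is an interval ([is_interval_image]), and an interval contains the averages
    ([mean_is_interval]) and the expectations ([expectation_is_interval]) of its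
    points.  The expectations exist because a finite mean squared deviation from
    any constant forces integrability ([integrable_of_sqr_dev]).

    For one coordinate, let W_k = Z_k - m be the centred variables.  Then
    [sum_sqr_dev] writes the sum of squared deviations from the sample mean as
    the quadratic form with coefficients (k == l) - 1/n in the W_k.  Independence
    kills the off-diagonal expectations ([expectation_mul_independent]), and the
    diagonal ones give n (1 - 1/n) v = (n - 1) v
    ([expectation_sample_variance]). *)

(** * Functions on an interval *)

(** As y tends to x within J, f y = q(y) (y - x) + f x, where the difference
    quotient q has a finite limit.  This covers endpoints and also a
    one-point J, where the punctured filter is trivial. *)
Lemma derivative_on_continuous (R : realType) (J : interval R) (f f' : R -> R) :
  derivative_on J f f' -> {within [set` J], continuous f}.
Proof.
move=> df; apply/subspace_continuousP => x /= Jx.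
have FF : Filter (within [set` J] x^') by exact: within_filter.
have yx : y @[y --> within [set` J] x^'] --> x.
  move=> U Ux; apply: cvg_within; exact: nbhs_dnbhs.
have := cvgD (cvgM (df x Jx) (cvgB yx (cvg_cst x))) (cvg_cst (f x)).
rewrite subrr mulr0 add0r => fx U fxU.
have nU : nbhs x [set y | y != x -> [set` J] y ->
    U ((f y - f x) / (y - x) * (y - x) + f x)] := fx FF FF FF FF FF U fxU.
suff : nbhs x [set y | [set` J] y -> U (f y)] by [].
apply: filterS nU => y /= Uy Jy.
have [->|yx0] := eqVneq y x; first exact: nbhs_singleton fxU.
by have := Uy yx0 Jy; rewrite divfK ?subrK// subr_eq0.
Qed.

Lemma is_interval_image (R : realType) (J : interval R) (f : R -> R) :
  {within [set` J], continuous f} -> is_interval (f @` [set` J]).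
Proof.
move=> cf; apply/connected_intervalP.
apply: connected_continuous_connected cf.
exact/connected_intervalP/interval_is_interval.
Qed.

(** Extending f by 0 off J makes it measurable on the whole line, so that it can
    be composed with random variables and tested against their distributions. *)
Lemma measurable_patch_interval (R : realType) (J : interval R) (f : R -> R) :
  {within [set` J], continuous f} -> measurable_fun [set: R] (f \_ [set` J]).
Proof.
move=> cf; apply/(measurable_restrictT f (measurable_itv J)).
apply: subspace_continuous_measurable_fun => //; exact: measurable_itv.
Qed.

(** An average lies between the least and the greatest of its terms; the upper
    bound is the lower one applied to the opposite terms. *)
Lemma mean_is_interval (R : realFieldType) (n : nat) (n0 : (0 < n)%N)
  (a : 'I_n -> R) (S : set R) :
  is_interval S -> (forall k, S (a k)) -> S (n%:R^-1 * \sum_k a k).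
Proof.
move=> iS Sa.
have nR : 0 < n%:R :> R by rewrite ltr0n.
have le (b : 'I_n -> R) : exists k, b k <= n%:R^-1 * \sum_k b k.
  apply: contrapT => /forallNP lt.
  have : \sum_(k < n) (n%:R^-1 * \sum_k b k) < \sum_k b k.
    apply: ltr_sum => [|k _]; first by apply/hasP; exists (Ordinal n0);
      rewrite ?mem_index_enum.
    by rewrite ltNge; exact/negP.
  by rewrite sumr_const card_ord -[ltLHS]mulr_natr mulrAC mulVf ?gt_eqF// mul1r ltxx.
have [k kle] := le a; have [l] := le (fun k => - a k).
rewrite sumrN mulrN lerN2 => lle.
by apply: (iS _ _ (Sa k) (Sa l)); rewrite kle lle.
Qed.

(** * Expectations of real random variables *)

Section expectation.
Context d (T : measurableType d) (R : realType) (P : probability T R).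
Implicit Types Y Z : T -> R.

(** Otherwise Y - E[Y] would be positive everywhere with integral 0, hence almost
    everywhere null, although the whole space has measure 1. *)
Lemma expectation_ge_value Y :
  P.-integrable [set: T] (EFin \o Y) -> exists w, ((Y w)%:E <= 'E_P[Y])%E.
Proof.
move=> iY; apply: contrapT => /forallNP lt.
have fE : 'E_P[Y]%E \is a fin_num by rewrite unlock integrable_fin_num.
set m := fine 'E_P[Y]%E.
have Em : 'E_P[Y]%E = m%:E by rewrite fineK.
have Ym w : m < Y w.
  by move/negP: (lt w); rewrite Em lee_fin -ltNge.
have mY : measurable_fun [set: T] Y by exact/measurable_EFinP/measurable_int/iY.
have : (\int[P]_w `|(Y w - m)%:E| = 0)%E.
  under eq_integral do rewrite gee0_abs ?lee_fin ?subr_ge0 ?ltW// EFinB.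
  rewrite integralB// ?integral_cst//=; last exact: finite_measure_integrable_cst.
  by move: Em; rewrite unlock => ->; rewrite probability_setT mule1 subee.
move/(ae_eq_integral_abs _ measurableT _).1.
case => [|N [mN N0 sub]].
  by apply/measurable_EFinP/measurable_funB.
have : P [set: T] = 0%E.
  rewrite -N0; congr (P _); apply/esym/seteqP; split=> // w _.
  apply: sub => /= /(_ I) [] /eqP; rewrite subr_eq0 => /eqP e.
  by have := Ym w; rewrite e ltxx.
by rewrite probability_setT => /eqP; rewrite onee_eq0.
Qed.

(** Comparing Y with the bounds of S would not exclude that E[Y] is an endpoint
    missing from S; values of Y, which are points of S, on both sides of E[Y]
    do. *)
Lemma expectation_is_interval Y (S : set R) : is_interval S ->
  P.-integrable [set: T] (EFin \o Y) -> (forall w, S (Y w)) ->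
  S (fine 'E_P[Y]%E).
Proof.
move=> iS iY SY.
have fE : 'E_P[Y]%E \is a fin_num by rewrite unlock integrable_fin_num.
have [w0 le0] := expectation_ge_value iY.
have iNY : P.-integrable [set: T] (EFin \o (fun w => - Y w)).
  exact: integrableN iY.
have [w1] := expectation_ge_value iNY.
have -> : ('E_P[fun w => (- Y w)%R] = - 'E_P[Y])%E.
  by rewrite unlock -integralN//; exact: integrable_add_def.
rewrite EFinN leeN2 => le1.
apply: (iS (Y w0) (Y w1)) => //.
by rewrite -!lee_fin fineK// le0 le1.
Qed.

Lemma expectation_sum_nneg (I : Type) (s : seq I) (Y : I -> T -> R) :
  (forall i, measurable_fun [set: T] (Y i)) -> (forall i w, 0 <= Y i w) ->
  ('E_P[fun w => (\sum_(i <- s) Y i w)%R] = \sum_(i <- s) 'E_P[Y i])%E.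
Proof.
move=> mY Y0; rewrite unlock -ge0_integral_sum//.
- by apply: eq_integral => w _; rewrite sumEFin.
- by move=> i; exact/measurable_EFinP.
- by move=> i w _; rewrite lee_fin.
Qed.

Lemma expectation_sum_integrable (I : Type) (s : seq I) (Y : I -> T -> R) :
  (forall i, P.-integrable [set: T] (EFin \o Y i)) ->
  ('E_P[fun w => (\sum_(i <- s) Y i w)%R] = \sum_(i <- s) 'E_P[Y i])%E.
Proof.
move=> iY; rewrite unlock -integral_sum//.
by apply: eq_integral => w _; rewrite sumEFin.
Qed.

Lemma integrable_sqr Y : measurable_fun [set: T] Y ->
  ('E_P[fun w => (Y w ^+ 2)%R] < +oo)%E ->
  P.-integrable [set: T] (EFin \o (fun w => Y w ^+ 2)).
Proof.
move=> mY; rewrite unlock => lt; apply/integrableP; split.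
  exact/measurable_EFinP/measurable_funX.
by under eq_integral do rewrite gee0_abs ?lee_fin ?sqr_ge0//.
Qed.

(** Because |yz| <= y^2 + z^2. *)
Lemma integrable_mul_sqr Y Z :
  measurable_fun [set: T] Y -> measurable_fun [set: T] Z ->
  P.-integrable [set: T] (EFin \o (fun w => Y w ^+ 2)) ->
  P.-integrable [set: T] (EFin \o (fun w => Z w ^+ 2)) ->
  P.-integrable [set: T] (EFin \o (fun w => Y w * Z w)).
Proof.
move=> mY mZ iY iZ.
apply: le_integrable (integrableD _ iY iZ) => //.
  exact/measurable_EFinP/measurable_funM.
move=> w _ /=; rewrite lee_fin.
rewrite [leRHS]ger0_norm ?addr_ge0 ?sqr_ge0// normrM.
rewrite -[Y w ^+ 2]real_normK ?num_real// -[Z w ^+ 2]real_normK ?num_real//.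
have := sqr_ge0 (`|Y w| - `|Z w|).
have := normr_ge0 (Y w); have := normr_ge0 (Z w).
by nra.
Qed.

(** On a probability space constants are square integrable, so Y - c, as its
    product with 1, is integrable. *)
Lemma integrable_of_sqr_dev Y (c : R) : measurable_fun [set: T] Y ->
  ('E_P[fun w => ((Y w - c) ^+ 2)%R] < +oo)%E ->
  P.-integrable [set: T] (EFin \o Y).
Proof.
move=> mY lt.
have mYc : measurable_fun [set: T] (fun w => Y w - c) by exact: measurable_funB.
have i2 := integrable_sqr mYc lt.
have i1 : P.-integrable [set: T] (EFin \o (fun w => (Y w - c) * 1)).
  apply: (integrable_mul_sqr (Z := cst 1)) => //.
  by under eq_fun do rewrite expr1n; exact: finite_measure_integrable_cst.
have ic : P.-integrable [set: T] (EFin \o cst c).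
  exact: finite_measure_integrable_cst.
apply: eq_integrable (integrableD _ i1 ic) => // w _ /=.
by rewrite -EFinD mulr1 subrK.
Qed.

End expectation.

(** * Identically distributed and independent variables *)

(** Both expectations are integrals against the same law.  Splitting f into
    its positive and negative parts reduces the change of variables to the
    nonnegative case. *)
Lemma expectation_identically_distributed d d' (T : measurableType d)
    (T' : measurableType d') (R : realType) (P : probability T R)
    (X Y : {RV P >-> T'}) (f : T' -> R) :
  measurable_fun [set: T'] f -> identically_distributed X Y ->
  ('E_P[f \o X] = 'E_P[f \o Y])%E.
Proof.
move=> mf XY.
have mF : measurable_fun [set: T'] (EFin \o f) by exact/measurable_EFinP.
have eqD (g : T' -> \bar R) : (\int[distribution P X]_y g y =
    \int[distribution P Y]_y g y)%E.
  by apply: eq_measure_integral => A mA _; exact: XY.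
have split (U : {RV P >-> T'}) : ('E_P[f \o U] =
    \int[distribution P U]_y (EFin \o f)^\+ y
    - \int[distribution P U]_y (EFin \o f)^\- y)%E.
  rewrite unlock integralE !ge0_integral_distribution//.
  - by congr (_ - _)%E; apply: eq_integral => w _ /=;
      rewrite ?funeposE ?funenegE.
  - exact: measurable_funeneg mF.
  - exact: measurable_funepos mF.
by rewrite !split !eqD.
Qed.

(** Independence says that the law of (Y, Z) agrees with the product of the laws
    on rectangles, hence everywhere; Fubini's theorem then factors the integral
    of yz. *)
Lemma expectation_mul_independent d (T : measurableType d) (R : realType)
    (P : probability T R) (Y Z : T -> R) :
  measurable_fun [set: T] Y -> measurable_fun [set: T] Z ->
  (forall A B, measurable A -> measurable B ->
    P (Y @^-1` A `&` Z @^-1` B) = (P (Y @^-1` A) * P (Z @^-1` B))%E) ->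
  P.-integrable [set: T] (EFin \o Y) -> P.-integrable [set: T] (EFin \o Z) ->
  P.-integrable [set: T] (EFin \o (fun w => Y w * Z w)) ->
  ('E_P[fun w => (Y w * Z w)%R] = 'E_P[Y] * 'E_P[Z])%E.
Proof.
move=> mY mZ indep iY iZ iYZ.
have mYZ : measurable_fun [set: T] (fun w => (Y w, Z w)).
  exact: measurable_fun_pair.
pose Yf : {RV P >-> R} := mfun_Sub (mem_set mY).
pose Zf : {RV P >-> R} := mfun_Sub (mem_set mZ).
pose YZ : {RV P >-> (R * R)%type} := mfun_Sub (mem_set mYZ).
have joint A : measurable A ->
    (distribution P Yf \x distribution P Zf)%E A = distribution P YZ A.
  by apply: product_measure_unique => B C mB mC; exact: indep.
pose mul := fun z : R * R => (z.1 * z.2)%:E.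
have mmul : measurable_fun [set: R * R] mul.
  by apply/measurable_EFinP; exact: measurable_funM.
have imul : (distribution P YZ).-integrable [set: R * R] mul.
  exact: integrable_pushforward.
have imul' : (distribution P Yf \x distribution P Zf)%E.-integrable
    [set: R * R] mul.
  apply/integrableP; split=> //.
  rewrite (eq_measure_integral (distribution P YZ)).
    by move/integrableP : imul => [].
  by move=> A mA _; exact: joint.
have iid (U : {RV P >-> R}) : P.-integrable [set: T] (EFin \o U) ->
    (distribution P U).-integrable [set: R] EFin.
  by move=> iU; apply: integrable_pushforward.
have EE (U : {RV P >-> R}) : P.-integrable [set: T] (EFin \o U) ->
    'E_P[U]%E = (\int[distribution P U]_y y%:E)%E.
  by move=> iU; rewrite unlock integral_distribution.
have -> : 'E_P[fun w => (Y w * Z w)%R]%E = (\int[distribution P YZ]_z mul z)%E.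
  by rewrite unlock integral_distribution.
rewrite (eq_measure_integral (distribution P Yf \x distribution P Zf)%E); last first.
  by move=> A mA _; exact/esym/joint.
rewrite -integral12_prod_meas1//.
have fZ : 'E_P[Z]%E \is a fin_num by rewrite unlock integrable_fin_num.
rewrite (eq_integral (fun y : R => y%:E * (fine 'E_P[Z])%:E)%E); last first.
  by move=> y _; rewrite fineK// (EE Zf)// -integralZl//; exact: (iid Zf).
by rewrite integralZr ?(iid Yf)// -(EE Yf)// fineK.
Qed.

Lemma independent_pair d d' (T : measurableType d) (T' : measurableType d')
    (R : realType) (P : probability T R) (X : nat -> {RV P >-> T'}) (k l : nat)
    (A B : set T') :
  mutually_independent X -> k != l -> measurable A -> measurable B ->
  P (X k @^-1` A `&` X l @^-1` B) = (P (X k @^-1` A) * P (X l @^-1` B))%E.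
Proof.
move=> indep kl mA mB.
have := indep [:: k; l] (fun j => if j == k then A else B).
rewrite !big_cons !big_nil setIT mule1 eqxx eq_sym (negPf kl); apply.
  by rewrite /= inE kl.
by move=> j; case: ifP.
Qed.

(** * Unbiasedness of the sample variance *)

(** The left-hand side is invariant under translation by m, and equals
    sum W_k^2 - (sum W_k)^2 / n with W_k = Z_k - m.  The bilinear form leaves
    only pairwise products to integrate. *)
Lemma sum_sqr_dev (R : realFieldType) (n : nat) (n0 : (0 < n)%N)
  (Z : 'I_n -> R) (m : R) :
  \sum_k (Z k - n%:R^-1 * \sum_l Z l) ^+ 2 =
  \sum_k \sum_l ((k == l)%:R - n%:R^-1) * ((Z k - m) * (Z l - m)).
Proof.
have nR : n%:R != 0 :> R by rewrite pnatr_eq0 -lt0n.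
pose W k := Z k - m; pose S := \sum_k W k.
have SZ : n%:R^-1 * \sum_l Z l = m + n%:R^-1 * S.
  rewrite /S /W sumrB sumr_const card_ord -mulr_natl; field; exact: nR.
rewrite SZ (eq_bigr (fun k => W k ^+ 2 - 2 * (n%:R^-1 * S) * W k
    + (n%:R^-1 * S) ^+ 2)); last by move=> k _; rewrite /W; ring.
rewrite [RHS](eq_bigr (fun k => W k ^+ 2 - n%:R^-1 * S * W k)); last first.
  move=> k _; under eq_bigr do rewrite mulrBl.
  rewrite sumrB; congr (_ - _).
    rewrite (bigD1 k) //= eqxx big1 ?addr0 ?mul1r// => l.
    by rewrite eq_sym => /negPf ->; rewrite mul0r.
  by rewrite -!mulr_sumr -/S mulrCA mulrC.
rewrite big_split !sumrB /= -!mulr_sumr sumr_const card_ord -/S -mulr_natl.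
by field; exact: nR.
Qed.

(** By [sum_sqr_dev] the sample variance is a combination of the products
    (Z_k - m) (Z_l - m), whose expectations are the hypotheses. *)
Lemma expectation_sample_variance d (T : measurableType d) (R : realType)
    (P : probability T R) (n : nat) (Z : 'I_n -> T -> R) (m v : R) :
  (1 < n)%N ->
  (forall k, measurable_fun [set: T] (Z k)) ->
  (forall k, 'E_P[fun w => ((Z k w - m) ^+ 2)%R]%E = v%:E) ->
  (forall k l, k != l ->
    'E_P[fun w => ((Z k w - m) * (Z l w - m))%R]%E = 0%E) ->
  'E_P[fun w => ((n%:R - 1)^-1 *
    \sum_k (Z k w - n%:R^-1 * \sum_l Z l w) ^+ 2)%R]%E = v%:E.
Proof.
move=> n1 mZ Zv Zcov.
have n0 : (0 < n)%N by exact: ltnW.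
have mW k : measurable_fun [set: T] (fun w => Z k w - m).
  exact: measurable_funB.
have iW2 k : P.-integrable [set: T] (EFin \o (fun w => (Z k w - m) ^+ 2)).
  by apply: integrable_sqr => //; rewrite Zv ltry.
have iWW k l :
    P.-integrable [set: T] (EFin \o (fun w => (Z k w - m) * (Z l w - m))).
  exact: integrable_mul_sqr.
pose c (k l : 'I_n) : R := (n%:R - 1)^-1 * ((k == l)%:R - n%:R^-1).
have icWW k l : P.-integrable [set: T]
    (EFin \o (fun w => c k l * ((Z k w - m) * (Z l w - m)))).
  by have := integrableZl measurableT (c k l) (iWW k l).
have EcWW k l : 'E_P[fun w => (c k l * ((Z k w - m) * (Z l w - m)))%R]%E =
    (if k == l then (n%:R^-1 * v)%:E else 0)%E.
  transitivity ((c k l)%:E * 'E_P[fun w => ((Z k w - m) * (Z l w - m))%R])%E.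
    by rewrite unlock -integralZl//; exact: iWW.
  have [<-|kl] := eqVneq k l; last by rewrite Zcov// mule0.
  rewrite [X in 'E_P[X]%E](_ : _ = fun w => (Z k w - m) ^+ 2) ?Zv//.
  rewrite -EFinM /c eqxx /=; congr (_ * _)%:E; field.
  by rewrite pnatr_eq0 -lt0n n0 subr_eq0 pnatr_eq1 gtn_eqF.
(* In the double sum only the n diagonal terms survive, each worth v / n. *)
rewrite (_ : (fun w => _) = fun w =>
    \sum_k \sum_l c k l * ((Z k w - m) * (Z l w - m))); last first.
  apply/funext => w; rewrite (sum_sqr_dev n0 _ m) mulr_sumr.
  apply: eq_bigr => k _; rewrite mulr_sumr; apply: eq_bigr => l _.
  by rewrite /c !mulrA.
rewrite expectation_sum_integrable => [|k]; last first.
  have := integrable_sum measurableT (index_enum 'I_n) (P := xpredT)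
    (fun l _ => icWW k l).
  by under eq_fun do rewrite sumEFin.
under eq_bigr => k _.
  rewrite expectation_sum_integrable// (eq_bigr _ (fun l _ => EcWW k l)).
  rewrite -big_mkcond (big_pred1 k) => [|l]; last by rewrite eq_sym.
  over.
rewrite sumEFin sumr_const card_ord; congr EFin; rewrite -[LHS]mulr_natl mulVKf//.
by rewrite pnatr_eq0 -lt0n.
Qed.

Theorem theorem4p2 (R : realType) (J : interval R)
  (phi phi' phi'' phi''' h H : R -> R)
  (phi_strictly_convex : strictly_convex_on J phi)
  (phi_derivative : derivative_on J phi phi')
  (phi'_derivative : derivative_on J phi' phi'')
  (phi''_derivative : derivative_on J phi'' phi''')
  (phi'''_continuous : {within [set` J], continuous phi'''})
  (phi''_gt0 : forall x, x \in J -> 0 < phi'' x)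
  (h_primitive : derivative_on J h (fun x => Num.sqrt (phi'' x)))
  (H_inverse : {in J, cancel h H})
  (K : nat) (d : measure_display) (T : measurableType d) (P : probability T R)
  (X : {RV P >-> K.-tuple R}) (Xs : nat -> {RV P >-> K.-tuple R})
  (X_valued : valued_in J X)
  (Xs_valued : forall k, valued_in J (Xs k))
  (Xs_independent : mutually_independent Xs)
  (Xs_distribution : forall k, identically_distributed (Xs k) X)
  (X_finite_variance : (d_variance P h H X < +oo)%E)
  (n : nat) (n_ge2 : (2 <= n)%N) :
  ('E_P[sample_d_variance h H n Xs] = d_variance P h H X)%E.
Proof.
have ch := derivative_on_continuous h_primitive.
have hJ := is_interval_image ch.
have hHK y : (h @` [set` J]) y -> h (H y) = y.
  by move=> [x Jx <-]; rewrite H_inverse.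
pose G i (x : K.-tuple R) := (h \_ [set` J]) (tnth x i).
have mG i : measurable_fun [set: K.-tuple R] (G i).
  apply: measurableT_comp (measurable_tnth i).
  exact: measurable_patch_interval.
have GE (U : T -> K.-tuple R) i w : valued_in J U ->
    tnth (map_tuple h (U w)) i = G i (U w).
  by move=> UJ; rewrite tnth_map /G patchE mem_set//; exact: UJ.
have GJ (U : T -> K.-tuple R) i w : valued_in J U ->
    (h @` [set` J]) (G i (U w)).
  by move=> UJ; rewrite -GE// tnth_map; exists (tnth (U w) i) => //; exact: UJ.
(* The i-th coordinate of E[h(X)]; its integrability is established below. *)
pose m i := fine 'E_P[G i \o X]%E.
have enorm2E (x y : K.-tuple R) :
    enorm2 (vsub x y) ^+ 2 = \sum_i (tnth x i - tnth y i) ^+ 2.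
  rewrite sqr_sqrtr ?sumr_ge0// => [|i _]; last exact: sqr_ge0.
  by apply: eq_bigr => i _; rewrite tnth_mktuple.
have mdev (U : {RV P >-> K.-tuple R}) i (c : R) :
    measurable_fun [set: T] (fun w => G i (U w) - c).
  by apply: measurable_funB => //; exact: measurableT_comp.
have varE : (d_variance P h H X =
    \sum_i 'E_P[fun w => ((G i (X w) - h (H (m i))) ^+ 2)%R])%E.
  rewrite -expectation_sum_nneg => [|i|i w]; last 2 first.
  - exact: measurable_funX.
  - exact: sqr_ge0.
  congr expectation; apply/funext => w; rewrite enorm2E.
  apply: eq_bigr => i _; rewrite GE// !tnth_map tnth_ord_tuple.
  congr ((_ - h (H (fine (expectation P _)))) ^+ 2).
  by apply/funext => w'; exact: GE.
have dev_lty i : ('E_P[fun w => ((G i (X w) - h (H (m i))) ^+ 2)%R] < +oo)%E.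
  apply: le_lt_trans X_finite_variance; rewrite varE (bigD1 i)//= leeDl//.
  apply: sume_ge0 => j _; apply: expectation_ge0 => w; exact: sqr_ge0.
have iG i : P.-integrable [set: T] (EFin \o (G i \o X)).
  by apply: integrable_of_sqr_dev (dev_lty i); exact: measurableT_comp.
(* Only now is m i a genuine expectation, hence a point of h(J). *)
have hHm i : h (H (m i)) = m i.
  apply: hHK; apply: expectation_is_interval => // w; exact: GJ.
have {}varE : (d_variance P h H X =
    \sum_i 'E_P[fun w => ((G i (X w) - m i) ^+ 2)%R])%E.
  by rewrite varE; apply: eq_bigr => i _; rewrite hHm.
have vfin i : 'E_P[fun w => ((G i (X w) - m i) ^+ 2)%R]%E \is a fin_num.
  rewrite ge0_fin_numE; last by apply: expectation_ge0 => w; exact: sqr_ge0.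
  by rewrite -hHm dev_lty.
have Xs_var k i : 'E_P[fun w => ((G i (Xs k w) - m i) ^+ 2)%R]%E =
    'E_P[fun w => ((G i (X w) - m i) ^+ 2)%R]%E.
  apply: (expectation_identically_distributed
    (f := fun x => (G i x - m i) ^+ 2)) (Xs_distribution k).
  by apply: measurable_funX; exact: measurable_funB.
have Xs_centred k i : 'E_P[fun w => (G i (Xs k w) - m i)%R]%E = 0%E.
  rewrite (expectation_identically_distributed
    (f := fun x => G i x - m i) _ (Xs_distribution k)); last first.
    exact: measurable_funB.
  rewrite (@expectationB _ _ _ _ (G i \o X) (cst (m i))).
  - rewrite expectation_cst /m fineK ?subee ?expectation_fin_num//;
      exact/Lfun1_integrable.
  - exact/Lfun1_integrable.
  - exact: Lfun_cst.
have Xs_sqr k i : P.-integrable [set: T]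
    (EFin \o (fun w => (G i (Xs k w) - m i) ^+ 2)).
  by apply: integrable_sqr => //; rewrite Xs_var ltey_eq vfin.
have Xs_int k i : P.-integrable [set: T]
    (EFin \o (fun w => G i (Xs k w) - m i)).
  apply: (integrable_of_sqr_dev (c := 0)) => //.
  by under eq_fun do rewrite subr0; rewrite Xs_var ltey_eq vfin.
have Xs_uncorrelated k l i : k != l ->
    'E_P[fun w => ((G i (Xs k w) - m i) * (G i (Xs l w) - m i))%R]%E = 0%E.
  move=> kl; rewrite expectation_mul_independent ?Xs_centred ?mule0//.
  - move=> A B mA mB.
    have mGA (C : set R) : measurable C ->
        measurable ((fun x => G i x - m i) @^-1` C).
      move=> mC; rewrite -[X in measurable X]setTI.
      by apply: measurable_funB.
    exact: (independent_pair Xs_independent kl (mGA A mA) (mGA B mB)).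
  - exact: integrable_mul_sqr.
rewrite varE.
have sampleE : sample_d_variance h H n Xs = fun w =>
    \sum_i ((n%:R - 1)^-1 * \sum_(k < n)
      (G i (Xs k w) - n%:R^-1 * \sum_(l < n) G i (Xs l w)) ^+ 2).
  apply/funext => w; rewrite /sample_d_variance -mulr_sumr exchange_big /=.
  congr (_ * _); apply: eq_bigr => k _; rewrite enorm2E.
  apply: eq_bigr => i _; rewrite GE// !tnth_map tnth_ord_tuple.
  congr ((_ - _) ^+ 2).
  rewrite (eq_bigr (fun k : 'I_n => G i (Xs k w))) => [|j _]; last exact: GE.
  by apply: hHK; apply: mean_is_interval => // [|j]; [exact: ltnW|exact: GJ].
rewrite sampleE expectation_sum_nneg => [|i|i w]; last 2 first.
- apply: measurable_funM => //; apply: measurable_sum => k.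
  apply: measurable_funX; apply: measurable_funB; first exact: measurableT_comp.
  apply: measurable_funM => //; apply: measurable_sum => l.
  exact: measurableT_comp.
- rewrite mulr_ge0 ?invr_ge0 ?subr_ge0 ?ler1n 1?ltnW//.
  by apply: sumr_ge0 => k _; exact: sqr_ge0.
apply: eq_bigr => i _; rewrite -[RHS]fineK//.
apply: (expectation_sample_variance (m := m i)) => // [k|k|k l kl].
- exact: measurableT_comp.
- by rewrite Xs_var fineK.
- exact: Xs_uncorrelated.
Qed.
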